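(* Let $\mathcal{H}$ be a real Hilbert space and let $\alpha_A,\alpha_B,\alpha_T\in\mathbb{R}$. Let $A,B:\mathcal{H}\rightrightarrows\mathcal{H}$ be maximally $\alpha_A$-monotone and maximally $\alpha_B$-monotone operators, respectively, and let $T:\mathcal{H}\to\mathcal{H}$ be a $\beta$-cocoercive and maximally $\alpha_T$-monotone operator, with $\beta>0$. Let $\theta>0$, $\sigma_A,\sigma_B\in\mathbb{R}$ and $\sigma_T\geq 0$ be such that $$\sigma_A+\sigma_B+\sigma_T>0\quad\text{and}\quad(\theta\alpha_A+\sigma_A,\ \theta\alpha_B+\sigma_B,\ \theta\alpha_T+\sigma_T)\in\mathbb{R}_+^3\setminus\{(0,0,0)\}.$$ Let $\mu:=(\theta/\beta+\sigma_T)^{-1}$ and $\gamma\in{]0,4\mu[}$, where $1+\gamma\sigma_A>0$ and $1+\gamma\sigma_B>0$. Consider a sequence $(\lambda_k)_{k\in\mathbb{N}}$ in $]0,2-\gamma/(2\mu)]$ verifying $\sum_{k\in\mathbb{N}}\lambda_k\left(2-\frac{\gamma}{2\mu}-\lambda_k\right)=+\infty$. Suppose $q\in\operatorname{ran}\left(\operatorname{Id}+\frac{\theta}{\sigma_A+\sigma_B+\sigma_T}(A+B+T)\right)$. Given any $x_0\in\mathcal{H}$, consider the sequences defined for $k=0,1,2,\ldots$ by $$\begin{aligned} u_k&=J_{\frac{\gamma\theta}{1+\gamma\sigma_A}A}\left(\frac{1}{1+\gamma\sigma_A}(x_k+\gamma\sigma_A q)\right),\\ v_k&=J_{\frac{\gamma\theta}{1+\gamma\sigma_B}B}\left(\frac{1}{1+\gamma\sigma_B}\bigl((2-\gamma\sigma_T)u_k-x_k-\theta\gamma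 T(u_k)+\gamma(\sigma_B+\sigma_T)q\bigr)\right),\\ x_{k+1}&=x_k+\lambda_k(v_k-u_k). \end{aligned}$$ Then $(u_k)_{k\in\mathbb{N}}$ and $(v_k)_{k\in\mathbb{N}}$ are weakly convergent to $J_{\frac{\theta}{\sigma_A+\sigma_B+\sigma_T}(A+B+T)}(q)$, and $(x_k)_{k\in\mathbb{N}}$ is weakly convergent to a point $\bar{x}$ with $$J_{\frac{\gamma\theta}{1+\gamma\sigma_A}A}\left(\frac{1}{1+\gamma\sigma_A}(\bar{x}+\gamma\sigma_A q)\right)=J_{\frac{\theta}{\sigma_A+\sigma_B+\sigma_T}(A+B+T)}(q).$$ Further, if $\theta\alpha_A+\sigma_A>0$ (respectively $\theta\alpha_B+\sigma_B>0$), then the convergence of $(u_k)_{k\in\mathbb{N}}$ (respectively $(v_k)_{k\in\mathbb{N}}$) is strong, even when $\sum_{k\in\mathbb{N}}\lambda_k\left(2-\frac{\gamma}{2\mu}-\lambda_k\right)<+\infty$.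
   Context: $\mathcal{H}$ is a real Hilbert space with inner product $\langle\cdot,\cdot\rangle$ and norm $\|\cdot\|$. A set-valued operator $A:\mathcal{H}\rightrightarrows\mathcal{H}$ assigns to each $x\in\mathcal{H}$ a subset $A(x)\subseteq\mathcal{H}$; $\operatorname{gra}A=\{(x,u):u\in A(x)\}$ and $\operatorname{ran}A=\{u:\exists x\in\mathcal{H},\ u\in A(x)\}$. For $\eta\in\mathbb{R}$, $A$ is $\eta$-monotone if $\langle x-y,u-v\rangle\geq\eta\|x-y\|^2$ for all $(x,u),(y,v)\in\operatorname{gra}A$, and maximally $\eta$-monotone if in addition no $\eta$-monotone operator has a graph properly containing $\operatorname{gra}A$. The resolvent of $A$ with parameter $\gamma>0$ is $J_{\gamma A}:=(\operatorname{Id}+\gamma A)^{-1}$; if $A$ is $\eta$-monotone and $1+\gamma\eta>0$, then $J_{\gamma A}$ is single-valued on its domain, and its domain is $\mathcal{H}$ if and only if $A$ is maximally $\eta$-monotone. $T:\mathcal{H}\to\mathcal{H}$ is $\beta$-cocoercive if $\langle x-y,T(x)-T(y)\rangle\geq\beta\|T(x)-T(y)\|^2$ for all $x,y\in\mathcal{H}$. $\mathbb{R}_+=[0,+\infty[$.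
   Formalization: In the final clause, when the sum of λ_k(2-γ/(2μ)-λ_k) is finite, strong convergence is proved, but the limit is identified as the resolvent value at q only if the sum of λ_k is infinite; for summable λ_k that identification is false. *)

(* Defs.v *)
From HB Require Import structures.
From mathcomp Require Import all_boot all_order all_algebra.
From mathcomp Require Import all_classical all_reals all_analysis.

Set Implicit Arguments.
Unset Strict Implicit.
Unset Printing Implicit Defensive.

Import Order.TTheory GRing.Theory Num.Theory.
Import numFieldNormedType.Exports.

Local Open Scope classical_set_scope.
Local Open Scope ring_scope.

(* A real Hilbert space is a complete normed module [H] over the reals whose
   norm comes from a positive definite symmetric bilinear form [ip]. *)
Definition norm_from_dot (R : realType) (H : completeNormedModType R)
    (ip : {dot H for (idfun : R -> R)}) : Prop :=
  forall x : H, `|x| ^+ 2 = ip x x.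

(* Weak convergence; in a Hilbert space the continuous linear functionals are
   exactly the maps [ip^~ y]. *)
Definition weakly_cvg (R : realType) (H : completeNormedModType R)
    (ip : {dot H for (idfun : R -> R)}) (u : nat -> H) (l : H) : Prop :=
  forall y : H, ip (u n) y @[n --> \oo] --> ip l y.

Definition operator (H : Type) := H -> set H.

Definition gra (H : Type) (A : operator H) : set (H * H) :=
  [set p | A p.1 p.2].

Definition ran (H : Type) (A : operator H) : set H :=
  [set u | exists x, A x u].

Definition op_inv (H : Type) (A : operator H) : operator H :=
  fun u => [set x | A x u].

Definition op_fun (H : Type) (T : H -> H) : operator H := fun x => [set T x].

Definition op_id (H : Type) : operator H := op_fun (@id H).

Definition op_add (H : zmodType) (A B : operator H) : operator H :=
  fun x => [set a + b | a in A x & b in B x].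

Definition op_scale (R : pzRingType) (H : lmodType R) (c : R) (A : operator H) :
    operator H :=
  fun x => [set c *: a | a in A x].

Definition resolvent (R : pzRingType) (H : lmodType R) (c : R) (A : operator H) :
    operator H :=
  op_inv (op_add (@op_id H) (op_scale c A)).

Definition monotone_op (R : realType) (H : completeNormedModType R)
    (ip : {dot H for (idfun : R -> R)}) (eta : R) (A : operator H) : Prop :=
  forall x y u v : H, A x u -> A y v ->
    eta * `|x - y| ^+ 2 <= ip (x - y) (u - v).

Definition max_monotone_op (R : realType) (H : completeNormedModType R)
    (ip : {dot H for (idfun : R -> R)}) (eta : R) (A : operator H) : Prop :=
  monotone_op ip eta A /\
  (forall A' : operator H, monotone_op ip eta A' -> ~ (gra A `<` gra A')).

Definition cocoercive (R : realType) (H : completeNormedModType R)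
    (ip : {dot H for (idfun : R -> R)}) (beta : R) (T : H -> H) : Prop :=
  forall x y : H, beta * `|T x - T y| ^+ 2 <= ip (x - y) (T x - T y).

(* Main.v *)
(* Absorb the shifts into the operators: A~ = theta A + sigmaA (Id - q), and
   likewise B~ and T~; these are monotone, T~ is mu-cocoercive, and the iteration
   is Davis-Yin splitting for A~ + B~ + T~, whose only zero is the resolvent p.
   For two runs of one step, with differences X, U, V of x, u, v and W = V - U,
     - <X, W> >= (1 - gamma / (4 mu)) |W|^2 + gamma a |U|^2 + gamma b |V|^2,
   where a, b are the monotonicity moduli of A~, B~. Hence |v_k - u_k| is
   nonincreasing and x is Fejer monotone. If the series diverges, then
   v_k - u_k -> 0, and since one of the three moduli is positive the inequality
   gives u, v -> p strongly; the weak convergence of x follows by Opial's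
   argument. If only the sum of lambda_k diverges, then the sum of
   lambda_k |u_k - p|^2 is finite while |u_(k+1) - u_k| = O(lambda_k), which
   forces u -> p; if it converges, x is a Cauchy sequence.
   Neither Minty's theorem nor weak compactness is needed: asymptotic centers
   play the role of weak cluster points. *)

Require Import Defs.
From HB Require Import structures.
From mathcomp Require Import all_boot all_order all_algebra.
From mathcomp Require Import all_classical all_reals all_analysis.
From mathcomp Require Import ring lra.

Import Order.TTheory GRing.Theory Num.Theory.
Import numFieldNormedType.Exports.

Local Open Scope classical_set_scope.
Local Open Scope ring_scope.

Set Implicit Arguments.
Unset Strict Implicit.

(** * Bilinear calculus and the Cauchy-Schwarz inequality *)

Section InnerProduct.
Context {R : realType} {H : completeNormedModType R}.
Context {ip : {dot H for (idfun : R -> R)}} (hip : norm_from_dot ip).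
Implicit Types x y z : H.

Lemma ipC x y : ip x y = ip y x.
Proof. by rewrite hermC /= expr0 mul1r. Qed.

Lemma ipDl x y z : ip (x + y) z = ip x z + ip y z.
Proof. exact: linearDl. Qed.

Lemma ipBl x y z : ip (x - y) z = ip x z - ip y z.
Proof. exact: linearBl. Qed.

Lemma ipNl x z : ip (- x) z = - ip x z.
Proof. exact: linearNl. Qed.

Lemma ipZl (a : R) x z : ip (a *: x) z = a * ip x z.
Proof. exact: linearZl_LR. Qed.

Lemma ipDr x y z : ip z (x + y) = ip z x + ip z y.
Proof. exact: linearDr. Qed.

Lemma ipBr x y z : ip z (x - y) = ip z x - ip z y.
Proof. exact: linearBr. Qed.

Lemma ipNr x z : ip z (- x) = - ip z x.
Proof. exact: linearNr. Qed.

Lemma ipZr (a : R) x z : ip z (a *: x) = a * ip z x.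
Proof. by rewrite ipC ipZl ipC. Qed.

Definition ipE := (ipDl, ipBl, ipNl, ipZl, ipDr, ipBr, ipNr, ipZr).

(** Reduces vector identities to scalar ones: test against an arbitrary [z], expand with [ipE], and
    finish with [ring] or [field]. *)
Lemma ip_inj x y : (forall z, ip x z = ip y z) -> x = y.
Proof.
move=> xy; apply/eqP; rewrite -subr_eq0 -normr_eq0 -sqrf_eq0 hip ipBl xy.
by rewrite subrr.
Qed.

Lemma ip_le_norm x y : ip x y <= `|x| * `|y|.
Proof.
have [->|x0] := eqVneq x 0; first by rewrite linear0l normr0 mul0r.
have [->|y0] := eqVneq y 0; first by rewrite linear0r normr0 mulr0.
have xp : 0 < `|x| by rewrite normr_gt0.
have yp : 0 < `|y| by rewrite normr_gt0.
(* This square equals 2 |x| |y| (|x| |y| - <x, y>). *)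
have : 0 <= `| `|y| *: x - `|x| *: y| ^+ 2 by rewrite exprn_ge0.
rewrite hip !ipE (ipC y x) -(hip x) -(hip y) => h.
have : 0 <= (`|x| * `|y|) * (`|x| * `|y| - ip x y) by lra.
by rewrite pmulr_rge0 ?mulr_gt0// subr_ge0.
Qed.

Lemma norm_ip_le x y : `|ip x y| <= `|x| * `|y|.
Proof.
by rewrite ler_norml ip_le_norm andbT lerNl -ipNl (le_trans (ip_le_norm _ _))// normrN.
Qed.

End InnerProduct.

(** * Estimates for the difference of two runs of one Davis-Yin step *)

Section DavisYin.
Context {R : realType} {H : completeNormedModType R}.
Context {ip : {dot H for (idfun : R -> R)}} (hip : norm_from_dot ip).
Context {a b t mu gamma : R}.
Hypotheses (a0 : 0 <= a) (b0 : 0 <= b) (mu0 : 0 < mu).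
Hypothesis hgamma : 0 < gamma < 4 * mu.

(* [X], [U], [V], [D] are the differences, between two runs of one step of the
   iteration, of the input [x], of [u], of [v] and of [theta T u + sigmaT u];
   [a], [b], [t] are the moduli of monotonicity of the shifted operators. *)
Definition step_diff (X U V D : H) : Prop :=
  [/\ gamma * a * `|U| ^+ 2 <= ip U (X - U),
      gamma * b * `|V| ^+ 2 <= ip V (2 *: U - X - gamma *: D - V),
      mu * `|D| ^+ 2 <= ip U D
    & t * `|U| ^+ 2 <= ip U D].

Let c := 2 - gamma / (2 * mu).

Context {X U V D : H} (hstep : step_diff X U V D).
Let W := V - U.

Let gamma0 : 0 < gamma. Proof. by case/andP: hgamma. Qed.

Lemma relaxation_gt0 : 0 < c.
Proof.
case/andP: hgamma => _ h.
by rewrite /c subr_gt0 ltr_pdivrMr; [lra|rewrite mulr_gt0].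
Qed.

Let ip_UVE : ip U (X - U) + ip V (2 *: U - X - gamma *: D - V) =
  - ip X W - `|W| ^+ 2 - gamma * ip U D - gamma * ip W D.
Proof.
rewrite (hip W) /W !(ipE) (ipC X V) (ipC X U) (ipC V U); ring.
Qed.

(** Add the two resolvent inequalities through [ip_UVE]. Cocoercivity pays for the cross term <W,
    D>, at the price of gamma / (4 mu) |W|^2. *)
Lemma step_diff_ip :
  c / 2 * `|W| ^+ 2 + gamma * a * `|U| ^+ 2 + gamma * b * `|V| ^+ 2
    <= - ip X W.
Proof.
have [h1 h2 h3 _] := hstep.
(* Completing the square: the shift by W / (2 mu) makes the cross term exactly gamma <W, D>. *)
have : 0 <= gamma * mu * `|D + (2 * mu)^-1 *: W| ^+ 2.
  by rewrite !mulr_ge0// ?exprn_ge0// ltW.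
have -> : gamma * mu * `|D + (2 * mu)^-1 *: W| ^+ 2 =
    gamma * (mu * `|D| ^+ 2) + gamma * ip W D + gamma / (4 * mu) * `|W| ^+ 2.
  move: W => Z; rewrite (hip (_ + _)) !ipE (ipC D Z) -(hip Z) -(hip D).
  by field; rewrite gt_eqF.
have : gamma * (mu * `|D| ^+ 2) <= gamma * ip U D by rewrite ler_pM2l.
have -> : c / 2 = 1 - gamma / (4 * mu).
  by rewrite /c; field; rewrite gt_eqF.
move: ip_UVE; lra.
Qed.

(** Expand |X + l W|^2 and bound 2 l <X, W> by [step_diff_ip]; this is the relaxed step behind Fejer
    monotonicity. *)
Lemma step_diff_norm (l : R) : 0 < l ->
  `|X + l *: W| ^+ 2 + l * (c - l) * `|W| ^+ 2
    + 2 * gamma * a * (l * `|U| ^+ 2) + 2 * gamma * b * (l * `|V| ^+ 2)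
  <= `|X| ^+ 2.
Proof.
move=> l0; move: step_diff_ip; rewrite -(ler_pM2l l0).
move: W => Z; rewrite (hip (_ + _)) !ipE (ipC Z X) -(hip X) -(hip Z); lra.
Qed.

Lemma step_diff_normU : `|U| <= `|X|.
Proof.
have [h1 _ _ _] := hstep.
have [->|U0] := eqVneq U 0; first by rewrite normr0.
have Up : 0 < `|U| by rewrite normr_gt0.
rewrite -(ler_pM2l Up).
apply: le_trans (ip_le_norm hip U X); rewrite -expr2.
have : 0 <= gamma * a * `|U| ^+ 2 by rewrite !mulr_ge0// ?exprn_ge0// ltW.
by move: h1; rewrite ipBr -(hip U); lra.
Qed.

Lemma step_diff_normD : mu * `|D| <= `|X|.
Proof.
apply: le_trans step_diff_normU.
have [_ _ h3 _] := hstep.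
have [->|D0] := eqVneq D 0; first by rewrite normr0 mulr0.
have Dp : 0 < `|D| by rewrite normr_gt0.
rewrite -(ler_pM2r Dp) -mulrA -expr2.
exact: le_trans (ip_le_norm hip U D).
Qed.

Lemma step_diff_normV : `|V| <= (3 + gamma / mu) * `|X|.
Proof.
have [_ h2 _ _] := hstep.
have Y : `|2 *: U - X - gamma *: D| <= (3 + gamma / mu) * `|X|.
  have hD : gamma * `|D| <= gamma / mu * `|X|.
    rewrite -mulrA ler_pM2l// mulrC ler_pdivlMr// mulrC.
    exact: step_diff_normD.
  have hU := step_diff_normU.
  have := ler_normB (2 *: U - X) (gamma *: D).
  have := ler_normB (2 *: U) X.
  rewrite !normrZ (gtr0_norm gamma0) ger0_norm//; lra.
apply: le_trans Y.
have [->|V0] := eqVneq V 0; first by rewrite normr0.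
have Vp : 0 < `|V| by rewrite normr_gt0.
rewrite -(ler_pM2l Vp).
apply: le_trans (ip_le_norm hip V _); rewrite -expr2.
have : 0 <= gamma * b * `|V| ^+ 2 by rewrite !mulr_ge0// ?exprn_ge0// ltW.
by move: h2; rewrite [ip V (_ - V)]ipBr -(hip V); lra.
Qed.

(** Serves the case where only the modulus [t] is positive: <U, D> is kept to bound |U|^2 instead of
    being spent on the square, and <W, D> is handled by Cauchy-Schwarz and the Lipschitz bound on
    D. *)
Lemma step_diff_strongT :
  gamma * t * `|U| ^+ 2 <= `|W| * ((1 + gamma / mu) * `|X|).
Proof.
have [_ _ _ h4] := hstep.
have hD : gamma * `|D| <= gamma / mu * `|X|.
  rewrite -mulrA ler_pM2l// mulrC ler_pdivlMr// mulrC.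
  exact: step_diff_normD.
have : gamma * (t * `|U| ^+ 2) <= gamma * ip U D by rewrite ler_pM2l.
have [h1 h2 _ _] := hstep.
have pU : 0 <= gamma * a * `|U| ^+ 2 by rewrite !mulr_ge0// ?exprn_ge0// ltW.
have pV : 0 <= gamma * b * `|V| ^+ 2 by rewrite !mulr_ge0// ?exprn_ge0// ltW.
have pW : 0 <= `|W| ^+ 2 by rewrite exprn_ge0.
have wX : - ip X W <= `|W| * `|X|.
  by move: W => Z; rewrite ipC -ipNl -(normrN Z); apply: ip_le_norm.
have wD : - (gamma * ip W D) <= `|W| * (gamma / mu * `|X|).
  apply: (@le_trans _ _ (`|W| * (gamma * `|D|))); last by rewrite ler_wpM2l.
  move: W => Z; rewrite mulrCA -mulrN ler_pM2l// -ipNl -(normrN Z).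
  exact: ip_le_norm.
move: ip_UVE; lra.
Qed.

End DavisYin.
Arguments step_diff {R H} ip a b t mu gamma X U V D.

(** * Asymptotic centers and closedness of maximally monotone graphs *)

Section WeakCluster.
Context {R : realType} {H : completeNormedModType R}.
Context {ip : {dot H for (idfun : R -> R)}} (hip : norm_from_dot ip).
Context {I : Type} {F : set_system I} {FF : ProperFilter F}.
Implicit Types (x h : I -> H) (z e : H).

(* Every weak cluster point of [x] along [F] has this property; conversely it
   says that [z] lies in each closed half-space that contains almost all of [x]
   up to an arbitrarily small error. *)
Definition weak_center x z : Prop :=
  forall e (d : R), 0 < d -> ~ \forall k \near F, d <= ip (x k - z) e.

(* The asymptotic center, i.e. the minimizer of [limsup |x - z|], plays the role
   of a weak limit of a subsequence: it exists by completeness alone. *)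
Lemma ex_weak_center x (M : R) :
  (\forall k \near F, `|x k| <= M) -> exists z, weak_center x z.
Proof.
move=> xM.
(* [inf C] is the least squared asymptotic radius of [x] along [F]; points [z n] nearly attaining it
   are shown to converge to a minimizer. *)
pose C := [set c : R | exists z, \forall k \near F, `|x k - z| ^+ 2 <= c].
have Cinf : has_inf C.
  split.
    exists (M ^+ 2), 0; apply: filterS xM => k; rewrite subr0 => xM.
    by rewrite lerXn2r// nnegrE// (le_trans _ xM).
  exists 0 => c [z /filter_ex[k]]; apply: le_trans; exact: exprn_ge0.
have Cge c : C c -> inf C <= c by apply: ge_inf; case: Cinf.
set r := inf C in Cge.
have r0 : 0 <= r.
  apply: lb_le_inf; first by case: Cinf.
  by move=> c [z /filter_ex[k]]; apply: le_trans; exact: exprn_ge0.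
have ex_approx n : exists z, \forall k \near F, `|x k - z| ^+ 2 <= r + n.+1%:R^-1.
  have n0 : (0 : R) < n.+1%:R^-1 by rewrite invr_gt0.
  have [c [w hw] cr] := inf_adherent n0 Cinf.
  by exists w; apply: filterS hw => k /le_trans; apply; exact: ltW.
have [z hz] := boolp.choice ex_approx.
(* By the parallelogram law the midpoint of [z n] and [z m] would beat the radius [r] if the two
   were far apart, so [z] is Cauchy. *)
have zz n m : `|z n - z m| ^+ 2 <= 2 * (n.+1%:R^-1 + m.+1%:R^-1).
  move: (hz n) (hz m); move: n.+1%:R^-1 m.+1%:R^-1 => en em hn hm.
  suff /Cge : C ((r + en + (r + em)) / 2 - `|z n - z m| ^+ 2 / 4).
    by lra.
  exists (2^-1 *: (z n + z m)); near=> k.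
  have -> : `|x k - 2^-1 *: (z n + z m)| ^+ 2 =
      (`|x k - z n| ^+ 2 + `|x k - z m| ^+ 2) / 2 - `|z n - z m| ^+ 2 / 4.
    rewrite !hip !ipE (ipC (z n) (x k)) (ipC (z m) (x k)) (ipC (z m) (z n)).
    by field.
  have h1 : `|x k - z n| ^+ 2 <= r + en by near: k.
  have h2 : `|x k - z m| ^+ 2 <= r + em by near: k.
  lra.
have zcvg : cvgn z.
  apply: cauchy_cvg; apply: cauchy_exP => e e0.
  have [n hn] : exists n, 4 * n.+1%:R^-1 < e ^+ 2.
    have e20 : 0 < e ^+ 2 / 4 by rewrite divr_gt0// exprn_gt0.
    have /cvgrPdist_lt/(_ _ e20)[n _ /(_ n (leqnn n))] := @cvg_harmonic R.
    rewrite /= sub0r normrN ger0_norm ?invr_ge0// => hn; exists n.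
    by rewrite mulrC -ltr_pdivlMr.
  exists (z n); exists n => // m /= nm; rewrite -ball_normE /ball_/=.
  rewrite -(@ltr_pXn2r _ 2)// ?nnegrE// ?ltW//.
  apply: le_lt_trans (zz n m) (le_lt_trans _ hn).
  have : (m.+1%:R^-1 : R) <= n.+1%:R^-1 by rewrite lef_pV2 ?posrE// ler_nat.
  by move: n.+1%:R^-1 m.+1%:R^-1 => en em; lra.
set zl := limn z in zcvg.
have hzl (e : R) : 0 < e -> \forall k \near F, `|x k - zl| ^+ 2 <= r + e.
  move=> e0.
  pose eta := Num.min 1 (e / (2 * r + 8)).
  have eta0 : 0 < eta by rewrite lt_min ltr01 divr_gt0//; lra.
  have eta1 : eta <= 1 by rewrite ge_min lexx.
  have eta2 : eta * (2 * r + 8) <= e.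
    by rewrite -ler_pdivlMr ?ge_min ?lexx ?orbT//; lra.
  have /cvgrPdist_lt/(_ _ eta0) H1 := zcvg.
  have /cvgrPdist_lt/(_ _ eta0) H2 := @cvg_harmonic R.
  have [n [/= n1 n2]] := filter_ex (filterI H1 H2).
  move: n2; rewrite sub0r normrN ger0_norm ?invr_ge0// => n2.
  move: (hz n) n2; move: n.+1%:R^-1 => en hzn n2.
  apply: filterS hzn => k hk.
  have hk1 : `|x k - z n| <= r + 2.
    rewrite -(@ler_pXn2r _ 2)// ?nnegrE//; last lra.
    apply: le_trans hk _; have : 0 <= r ^+ 2 by exact: exprn_ge0.
    lra.
  have tri : `|x k - zl| <= `|x k - z n| + eta.
    have -> : x k - zl = x k - z n - (zl - z n) by apply/(ip_inj hip) => w; rewrite !ipE; ring.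
    apply: le_trans (ler_normB _ _) _; rewrite lerD2l ltW//.
  have : `|x k - zl| ^+ 2 <= (`|x k - z n| + eta) ^+ 2.
    by rewrite lerXn2r// nnegrE// addr_ge0// ltW.
  have : eta * `|x k - z n| <= eta * (r + 2) by rewrite ler_pM2l.
  have : eta * eta <= eta by rewrite ger_pMr.
  lra.
exists zl => e d d0 hd.
(* If [x] stayed beyond margin [d] in direction [e], moving the center by [s *: e] would lower the
   squared radius by at least s d / 2. *)
pose s := d / (`|e| ^+ 2 + 1).
have e1 : 0 < `|e| ^+ 2 + 1 by rewrite ltr_wpDl// exprn_ge0.
have s0 : 0 < s by rewrite divr_gt0.
have sd : s * d = s ^+ 2 * `|e| ^+ 2 + s ^+ 2 by rewrite /s; field; rewrite gt_eqF.
have s2 : 0 < s ^+ 2 by rewrite exprn_gt0.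
have sd2 : 0 < s * d / 2 by rewrite divr_gt0// mulr_gt0.
suff /Cge : C (r - s * d / 2) by lra.
exists (zl + s *: e); near=> k.
have h1 : d <= ip (x k - zl) e by near: k.
have h2 : `|x k - zl| ^+ 2 <= r + s * d / 2 by near: k; exact: hzl.
have -> : x k - (zl + s *: e) = x k - zl - s *: e by rewrite opprD addrA.
move: h1 h2 => + +; move: (x k - zl) => y h1 h2.
rewrite hip !ipE (ipC e y) -(hip y) -(hip e).
have : s * d <= s * ip y e by rewrite ler_pM2l.
lra.
Unshelve. all: by end_near. Qed.

(** A gap between [ip z e] and [m] would leave a fixed positive margin in direction [e] or [- e],
    which a weak center forbids. *)
Lemma weak_center_lim x z e (m : R) : weak_center x z ->
  ip (x k) e @[k --> F] --> m -> ip z e = m.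
Proof.
move=> xz xm; apply/eqP; rewrite eq_le; apply/andP; split; rewrite leNgt; apply/negP => zm.
- have d0 : 0 < (ip z e - m) / 2 by lra.
  apply: (xz (- e) _ d0).
  move/cvgrPdist_lt : xm => /(_ _ d0); apply: filterS => k.
  by rewrite !ipE ltr_norml => /andP[h1 h2]; lra.
- have d0 : 0 < (m - ip z e) / 2 by lra.
  apply: (xz e _ d0).
  move/cvgrPdist_lt : xm => /(_ _ d0); apply: filterS => k.
  by rewrite !ipE ltr_norml => /andP[h1 h2]; lra.
Qed.

Lemma weak_center_affine x h (s : R) z l : weak_center x z ->
  h k @[k --> F] --> l -> weak_center (fun k => s *: x k + h k) (s *: z + l).
Proof.
move=> xz hl e d d0 hd.
have d2 : 0 < d / 2 by rewrite divr_gt0.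
apply: (xz (s *: e) _ d2).
have e1 : 0 < `|e| + 1 by rewrite ltr_wpDl.
have de : 0 < d / 2 / (`|e| + 1) by rewrite divr_gt0.
move/cvgrPdist_lt : hl => /(_ _ de) hl; near=> k.
have h1 : d <= ip (s *: x k + h k - (s *: z + l)) e by near: k.
have h2 : `|l - h k| < d / 2 / (`|e| + 1) by near: k.
have h3 : ip (h k - l) e <= d / 2.
  apply: le_trans (ip_le_norm hip _ _) _; rewrite distrC.
  apply: (@le_trans _ _ (`|l - h k| * (`|e| + 1))); first by rewrite ler_wpM2l// lerDl.
  by rewrite -ler_pdivlMr// ltW.
move: h1 h3; rewrite !ipE; lra.
Unshelve. all: by end_near. Qed.

(** Adjoining [(p, w)] to the graph keeps it monotone, so maximality puts the pair in the graph
    already. *)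
Lemma max_monotone_mem (alpha : R) (A : operator H) p w :
  max_monotone_op ip alpha A ->
  (forall y v, A y v -> alpha * `|p - y| ^+ 2 <= ip (p - y) (w - v)) -> A p w.
Proof.
move=> [Amono Amax] pw; apply: contrapT => nA.
pose A' : operator H := fun y => [set v | A y v \/ (y = p /\ v = w)].
apply: (Amax A'); last first.
  split; first by move=> [y v] /= Ayv; left.
  by move=> /(_ (p, w)) /= AA; apply: nA; apply: AA; right.
move=> y y' v v' [Ay|[-> ->]] [Ay'|[-> ->]].
- exact: Amono.
- rewrite distrC; have -> : ip (y - p) (v - w) = ip (p - y) (w - v).
    by rewrite !ipE; ring.
  exact: pw.
- exact: pw.
- by rewrite !subrr normr0 expr0n mulr0 linear0l.
Qed.

(** Strong-weak closedness of the graph. Since [g] is bounded, <u k - p, g k - v> vanishes, so a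
    violated inequality at [(p, w)] would keep <g k - w, p - y> above a positive margin. *)
Lemma max_monotone_closed (alpha : R) (A : operator H) (u g : I -> H) p w (M : R) :
  max_monotone_op ip alpha A -> (forall k, A (u k) (g k)) ->
  u k @[k --> F] --> p -> (\forall k \near F, `|g k| <= M) ->
  weak_center g w -> A p w.
Proof.
move=> Amax Aug up gM gw; apply: (max_monotone_mem Amax) => y v Ayv.
rewrite leNgt; apply/negP => lt.
(* Half the violation: the two error terms below take d / 2 each, and a margin [d] is left. *)
pose d := (alpha * `|p - y| ^+ 2 - ip (p - y) (w - v)) / 2.
have d0 : 0 < d by rewrite divr_gt0// subr_gt0.
apply: (gw (p - y) d d0).
have d2 : 0 < d / 2 by rewrite divr_gt0.
have cu : alpha * `|u k - y| ^+ 2 @[k --> F] --> alpha * `|p - y| ^+ 2.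
  apply: cvgMr; rewrite !expr2; apply: cvgM; apply: cvg_norm;
    by apply: cvgB => //; exact: cvg_cst.
have M1 : 0 < `|M| + `|v| + 1 by rewrite ltr_wpDl// addr_ge0.
have dM : 0 < d / 2 / (`|M| + `|v| + 1) by rewrite divr_gt0.
move/cvgrPdist_lt : cu => /(_ _ d2) cu.
move/cvgrPdist_lt : up => /(_ _ dM) up.
near=> k.
have h1 : `|p - u k| < d / 2 / (`|M| + `|v| + 1) by near: k.
have h2 : `|alpha * `|p - y| ^+ 2 - alpha * `|u k - y| ^+ 2| < d / 2 by near: k.
have h3 : `|g k| <= M by near: k.
have h4 : ip (u k - p) (g k - v) <= d / 2.
  apply: le_trans (ip_le_norm hip _ _) _; rewrite distrC.
  apply: (@le_trans _ _ (`|p - u k| * (`|M| + `|v| + 1))).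
    rewrite ler_wpM2l//; apply: le_trans (ler_normB _ _) _.
    by have := ler_norm M; lra.
  by rewrite -ler_pdivlMr// ltW.
have := Amax.1 _ _ _ _ (Aug k) Ayv.
have -> : ip (u k - y) (g k - v) =
    ip (g k - w) (p - y) + ip (p - y) (w - v) + ip (u k - p) (g k - v).
  by rewrite (ipC (g k - w)) !ipE; ring.
move: h2; rewrite ltr_norml => /andP[h2 h2']; rewrite /d in h2 h2' h4 *; lra.
Unshelve. all: by end_near. Qed.

Lemma max_monotone_closed_affine (alpha : R) (A : operator H) (u x h : I -> H)
    (s M : R) p z l :
  max_monotone_op ip alpha A -> (forall k, A (u k) (s *: x k + h k)) ->
  u k @[k --> F] --> p -> h k @[k --> F] --> l ->
  (forall k, `|x k| <= M) -> weak_center x z -> A p (s *: z + l).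
Proof.
move=> Amax Aug up hl xM xz.
apply: (@max_monotone_closed _ _ u _ _ _ (`|s| * M + (`|l| + 1)) Amax Aug up).
  move/cvgrPdist_lt : hl => /(_ _ ltr01); apply: filterS => k hk.
  apply: le_trans (ler_normD _ _) _; rewrite normrZ lerD ?ler_wpM2l//.
  have := lerB_dist (h k) l; rewrite distrC => h1.
  by lra.
exact: weak_center_affine.
Qed.

End WeakCluster.
Arguments weak_center {R H} ip {I} F x z.

(* For two candidate limits [z] and [z'] the squared distances converge, hence so
   does [ip (x k) (z' - z)], which forces [z = z']. *)
Lemma weakly_cvg_opial (R : realType) (H : completeNormedModType R)
    (ip : {dot H for (idfun : R -> R)}) (hip : norm_from_dot ip)
    (x : nat -> H) (Q : H -> Prop) (M : R) :
  (forall k, `|x k| <= M) ->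
  (forall F : set_system nat, ProperFilter F -> F `=>` \oo ->
     forall z, weak_center ip F x z -> Q z) ->
  (forall z, Q z -> cvgn (fun k => `|x k - z| ^+ 2)) ->
  exists2 z, Q z & weakly_cvg ip x z.
Proof.
move=> xM FQ Qcvg.
have [|z zc] := @ex_weak_center _ _ _ hip _ \oo _ x M; first exact: filterE.
have Qz : Q z by apply: FQ zc.
exists z => //.
suff one y (e : R) : 0 < e -> \forall k \near \oo, ip (x k - z) y < e.
  move=> y; apply/cvgrPdist_lt => e e0; near=> k.
  have h1 : ip (x k - z) y < e by near: k; exact: one.
  have h2 : ip (x k - z) (- y) < e by near: k; exact: one.
  by move: h1 h2; rewrite !ipE ltr_norml => h1 h2; apply/andP; split; lra.
move=> e0; apply: contrapT => notlt.
(* Restricting the filter to the indices where convergence fails replaces passing to a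
   subsequence. *)
pose E := [set k | e <= ip (x k - z) y].
have FE : ProperFilter (within E \oo).
  apply: Build_ProperFilter; rewrite /within /= => h; apply: notlt.
  by apply: filterS h => k hk; rewrite ltNge; apply/negP.
have sub : within E \oo `=>` \oo by exact: cvg_within.
have [|z' zc'] := @ex_weak_center _ _ _ hip _ (within E \oo) _ x M; first exact: filterE.
have Qz' : Q z' by apply: FQ zc'.
have zz' : z = z'.
  have [l hl] : exists l : R, ip (x k) (z' - z) @[k --> \oo] --> l.
    (* Polarization: 2 <x, z' - z> = |x - z|^2 - |x - z'|^2 - |z|^2 + |z'|^2. *)
    exists ((limn (fun k => `|x k - z| ^+ 2) - limn (fun k => `|x k - z'| ^+ 2)
             - `|z| ^+ 2 + `|z'| ^+ 2) / 2).
    rewrite (_ : (fun k => _) = fun k => (`|x k - z| ^+ 2 - `|x k - z'| ^+ 2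
             - `|z| ^+ 2 + `|z'| ^+ 2) / 2); last first.
      by apply/funext => k; rewrite !hip !ipE (ipC z (x k)) (ipC z' (x k)); field.
    apply: cvgMl; apply: cvgD; last exact: cvg_cst.
    apply: cvgB; last exact: cvg_cst.
    by apply: cvgB; apply: Qcvg.
  have h1 := weak_center_lim zc hl.
  have h2 := weak_center_lim zc' (cvg_trans (cvg_app _ sub) hl).
  apply/eqP; rewrite eq_sym -subr_eq0 -normr_eq0 -sqrf_eq0 hip ipBl h1 h2.
  by rewrite subrr.
rewrite -zz' in zc'.
by apply: (zc' y e e0); exact: withinT.
Unshelve. all: by end_near. Qed.

(** * Summability criteria for convergence *)

Section RealSequences.
Context {R : realType}.
Implicit Types (a l s : nat -> R).

Lemma nneseries_unbounded a : (forall k, 0 <= a k) ->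
  (\sum_(0 <= k <oo) (a k)%:E)%E = +oo%E ->
  forall M, exists n, M < \sum_(0 <= k < n) a k.
Proof.
move=> a0 aoo M; apply: contrapT => /forallNP h.
suff : (\sum_(0 <= k <oo) (a k)%:E <= M%:E)%E by rewrite aoo.
apply: lime_le; first by apply: is_cvg_nneseries => n _ _; rewrite lee_fin.
by apply: nearW => n; rewrite sumEFin lee_fin leNgt; apply/negP.
Qed.

Lemma nneseries_bounded a : (forall k, 0 <= a k) ->
  (\sum_(0 <= k <oo) (a k)%:E < +oo)%E ->
  exists M, forall n, \sum_(0 <= k < n) a k <= M.
Proof.
move=> a0 aoo; set S := (X in (X < _)%E) in aoo.
have S0 : (0 <= S)%E by apply: nneseries_ge0 => n _ _; rewrite lee_fin.
have Sfin : S \is a fin_num by rewrite ge0_fin_numE.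
exists (fine S) => n; rewrite -lee_fin fineK// -sumEFin.
by apply: nneseries_lim_ge => k _ _; rewrite lee_fin.
Qed.

(* If [e <= s m] for a late [m], then [s] stays above [e / 2] forever: the tail of
   the convergent sum is too small for it to descend. This contradicts the
   divergence of the sum of [l]. *)
Lemma cvg0_of_summable l s (C M : R) :
  (forall k, 0 <= l k) -> (forall k, 0 <= s k) ->
  (forall n, \sum_(0 <= k < n) l k * s k ^+ 2 <= M) ->
  (forall K, exists n, K < \sum_(0 <= k < n) l k) ->
  (forall k, `|s k.+1 - s k| <= C * l k) ->
  s @ \oo --> 0.
Proof.
move=> l0 s0 lsM ldiv slip.
wlog C0 : C slip / 0 < C.
  move=> /(_ (`|C| + 1)); apply; last by rewrite ltr_wpDl.
  move=> k; apply: le_trans (slip k) _; rewrite ler_wpM2r//.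
  by have := ler_norm C; lra.
pose P n := \sum_(0 <= k < n) l k * s k ^+ 2.
pose T n := \sum_(0 <= k < n) l k.
have PS n : P n.+1 = P n + l n * s n ^+ 2 by rewrite /P big_nat_recr.
have TS n : T n.+1 = T n + l n by rewrite /T big_nat_recr.
have Pmono : {homo P : n m / (n <= m)%N >-> n <= m}.
  apply/nondecreasing_seqP => n; rewrite PS lerDl mulr_ge0// exprn_ge0//.
have Tmono : {homo T : n m / (n <= m)%N >-> n <= m}.
  by apply/nondecreasing_seqP => n; rewrite TS lerDl.
have Psup : has_sup (range P).
  by split; [exists (P 0%N), 0%N|exists M => _ [n _ <-]; exact: lsM].
apply/cvgr0Pnorm_lt => e e0.
(* Falling from [e] to e / 2 needs the sum of [l] to grow by e / (2 C), each unit costing at least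
   (e / 2)^2: in all (e / 2)^3 / C. *)
pose kap := e ^+ 3 / (8 * C).
have kap0 : 0 < kap by rewrite divr_gt0 ?exprn_gt0// mulr_gt0.
have [_ [N _ <-] hN] := sup_adherent kap0 Psup.
exists N => // m /= Nm; rewrite ger0_norm// ltNge; apply/negP => em.
have Pm n : (m <= n)%N -> P n - P m < kap.
  move=> mn; have : P n <= sup (range P) by apply: ub_le_sup; [case: Psup|exists n].
  by have := Pmono _ _ Nm; lra.
(* The two bounds need each other: the cost bound limits the growth of [T], hence the descent of
   [s], and [s] staying above e / 2 yields the next cost bound. *)
have inv j : (e / 2) ^+ 2 * (T (m + j)%N - T m) <= P (m + j)%N - P m /\
             s m - C * (T (m + j)%N - T m) <= s (m + j)%N.
  elim: j => [|j [IH1 IH2]]; first by rewrite addn0 !subrr !mulr0 subr0.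
  have Pj := Pm (m + j)%N (leq_addr _ _).
  have e4 : 0 < (e / 2) ^+ 2 by rewrite exprn_gt0// divr_gt0.
  have Tj : C * (T (m + j)%N - T m) <= e / 2.
    rewrite -(ler_pM2l e4) mulrCA.
    have -> : (e / 2) ^+ 2 * (e / 2) = C * kap.
      by rewrite /kap; field; rewrite gt_eqF.
    by rewrite ler_pM2l//; apply: le_trans IH1 (ltW Pj).
  have sj : e / 2 <= s (m + j)%N by lra.
  have sj2 : (e / 2) ^+ 2 <= s (m + j)%N ^+ 2.
    by rewrite lerXn2r// nnegrE// ltW// divr_gt0.
  rewrite addnS PS TS; split.
    have : l (m + j)%N * (e / 2) ^+ 2 <= l (m + j)%N * s (m + j)%N ^+ 2 by rewrite ler_wpM2l.
    lra.
  by have := slip (m + j)%N; rewrite ler_norml => /andP[h _]; lra.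
have e4 : 0 < (e / 2) ^+ 2 by rewrite exprn_gt0// divr_gt0.
have [n hn] := ldiv (T m + kap / (e / 2) ^+ 2).
rewrite -/(T n) in hn.
have mn : (m <= n)%N.
  rewrite leqNgt; apply/negP => /ltnW /Tmono nm.
  have : 0 < kap / (e / 2) ^+ 2 by rewrite divr_gt0.
  lra.
have [+ _] := inv (n - m)%N; rewrite subnKC// => h.
have := Pm n mn; apply/negP; rewrite -leNgt; apply: le_trans h.
by rewrite mulrC -ler_pdivrMr//; lra.
Qed.

End RealSequences.

(** Telescoping gives |w n - w N| <= C (T n - T N), with [T] the convergent partial sums of [l]. *)
Lemma cvg_of_summable_steps (R : realType) (H : completeNormedModType R)
    (w : nat -> H) (l : nat -> R) (C M : R) :
  (forall k, 0 <= l k) -> (forall n, \sum_(0 <= k < n) l k <= M) ->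
  (forall k, `|w k.+1 - w k| <= C * l k) -> cvgn w.
Proof.
move=> l0 lM wl.
wlog C0 : C wl / 0 < C.
  move=> /(_ (`|C| + 1)); apply; last by rewrite ltr_wpDl.
  move=> k; apply: le_trans (wl k) _; rewrite ler_wpM2r//.
  by have := ler_norm C; lra.
pose T n := \sum_(0 <= k < n) l k.
have TS n : T n.+1 = T n + l n by rewrite /T big_nat_recr.
have Tsup : has_sup (range T).
  by split; [exists (T 0%N), 0%N|exists M => _ [n _ <-]; exact: lM].
apply: cauchy_cvg; apply: cauchy_exP => e e0.
have eC : 0 < e / C by rewrite divr_gt0.
have [_ [N _ <-] hN] := sup_adherent eC Tsup.
exists (w N); exists N => // n /= Nn; rewrite -ball_normE /ball_/= distrC.
have Tn : T n <= sup (range T) by apply: ub_le_sup; [case: Tsup|exists n].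
suff : `|w n - w N| <= C * (T n - T N).
  move/le_lt_trans; apply; rewrite mulrC -ltr_pdivlMr//; lra.
rewrite -(subnKC Nn); elim: (n - N)%N => [|j IH].
  by rewrite addn0 !subrr normr0 mulr0.
rewrite addnS TS.
have -> : w (N + j).+1 - w N = (w (N + j).+1 - w (N + j)%N) + (w (N + j)%N - w N).
  by rewrite addrA subrK.
have := ler_normD (w (N + j).+1 - w (N + j)%N) (w (N + j)%N - w N).
by have := wl (N + j)%N; lra.
Qed.

Lemma cvg_of_sqr_norm (R : realType) (H : completeNormedModType R)
    (f : nat -> H) (l : H) (r : nat -> R) (kap K : R) : 0 < kap ->
  (forall k, kap * `|f k - l| ^+ 2 <= r k * K) -> r @ \oo --> 0 ->
  f @ \oo --> l.
Proof.
move=> kap0 fr /cvgr0Pnorm_lt r0; apply/cvgrPdist_lt => e e0.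
have K0 : 0 < `|K| + 1 by rewrite ltr_wpDl.
have d0 : 0 < kap * e ^+ 2 / (`|K| + 1) by rewrite divr_gt0// mulr_gt0// exprn_gt0.
apply: filterS (r0 _ d0) => k; rewrite ltr_pdivlMr// => rk.
rewrite distrC -(@ltr_pXn2r _ 2)// ?nnegrE// ?ltW// -(ltr_pM2l kap0).
apply: le_lt_trans (fr k) (le_lt_trans _ rk).
apply: le_trans (ler_norm _) _; rewrite normrM ler_wpM2l// lerDl//.
Qed.

Lemma cvg_weakly_cvg (R : realType) (H : completeNormedModType R)
    (ip : {dot H for (idfun : R -> R)}) (u : nat -> H) (p : H) :
  norm_from_dot ip -> u @ \oo --> p -> weakly_cvg ip u p.
Proof.
move=> hip /cvgrPdist_lt up y; apply/cvgrPdist_lt => e e0.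
have y1 : 0 < `|y| + 1 by rewrite ltr_wpDl.
have d0 : 0 < e / (`|y| + 1) by rewrite divr_gt0.
apply: filterS (up _ d0) => k; rewrite ltr_pdivlMr// => uk.
rewrite -ipBl; apply: le_lt_trans (norm_ip_le hip _ _) (le_lt_trans _ uk).
by rewrite ler_wpM2l// lerDl.
Qed.

(** * Convergence of the iterates of an abstract step relation *)

Section Run.
Context {R : realType} {H : completeNormedModType R}.
Context {ip : {dot H for (idfun : R -> R)}} (hip : norm_from_dot ip).
Context {a b t mu gamma : R}.
Hypotheses (a0 : 0 <= a) (b0 : 0 <= b) (mu0 : 0 < mu).
Hypothesis hgamma : 0 < gamma < 4 * mu.

Let c := 2 - gamma / (2 * mu).

Context {step : H -> H -> H -> H -> Prop}.
Hypothesis step_pair : forall x u v d x' u' v' d',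
  step x u v d -> step x' u' v' d' ->
  step_diff ip a b t mu gamma (x - x') (u - u') (v - v') (d - d').

Context {lambda : nat -> R} {x u v d : nat -> H}.
Hypothesis hlambda : forall k, 0 < lambda k <= c.
Hypothesis hstep : forall k, step (x k) (u k) (v k) (d k).
Hypothesis hx : forall k, x k.+1 = x k + lambda k *: (v k - u k).

Let gamma0 : 0 < gamma. Proof. by case/andP: hgamma. Qed.
Let lambda0 k : 0 < lambda k. Proof. by case/andP: (hlambda k). Qed.
Let relax0 k : 0 <= lambda k * (c - lambda k).
Proof. by case/andP: (hlambda k) => h1 h2; rewrite mulr_ge0 ?subr_ge0// ltW. Qed.

(** Apply [step_diff_ip] to consecutive steps, where X is [lambda k] times the old residual w. As
    [lambda k <= c], it yields |w' - w|^2 <= - 2 <w, w' - w>, that is |w'| <= |w|. *)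
Lemma residual_nonincreasing :
  {homo (fun k => `|v k - u k|) : n m / (n <= m)%N >-> m <= n}.
Proof.
apply/nonincreasing_seqP => k.
have := step_diff_ip hip mu0 hgamma (step_pair (hstep k.+1) (hstep k)).
have -> : v k.+1 - v k - (u k.+1 - u k) = (v k.+1 - u k.+1) - (v k - u k).
  by rewrite !opprD addrACA.
have -> : x k.+1 - x k = lambda k *: (v k - u k) by rewrite hx addrAC subrr add0r.
rewrite -/c; move: (v k.+1 - u k.+1) (v k - u k) => w' w h.
have pU : 0 <= gamma * a * `|u k.+1 - u k| ^+ 2.
  by rewrite !mulr_ge0// ?exprn_ge0// ltW.
have pV : 0 <= gamma * b * `|v k.+1 - v k| ^+ 2.
  by rewrite !mulr_ge0// ?exprn_ge0// ltW.
rewrite -(@ler_pXn2r _ 2)// ?nnegrE// -subr_ge0 -(pmulr_rge0 _ (lambda0 k)).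
have hl : lambda k / 2 * `|w' - w| ^+ 2 <= c / 2 * `|w' - w| ^+ 2.
  by rewrite ler_wpM2r ?exprn_ge0// ler_pM2r//; case/andP: (hlambda k).
have : lambda k / 2 * `|w' - w| ^+ 2 <= - ip (lambda k *: w) (w' - w) by lra.
rewrite (hip (w' - w)) !ipE (ipC w' w) -(hip w) -(hip w'); lra.
Qed.

Let norm_dx k : `|x k.+1 - x k| <= `|v 0%N - u 0%N| * lambda k.
Proof.
rewrite hx addrAC subrr add0r normrZ (gtr0_norm (lambda0 k)) mulrC.
by rewrite ler_pM2r//; apply: residual_nonincreasing.
Qed.

Let norm_du k : `|u k.+1 - u k| <= `|v 0%N - u 0%N| * lambda k.
Proof.
apply: le_trans _ (norm_dx k).
apply: (step_diff_normU hip a0 hgamma (step_pair (hstep k.+1) (hstep k))).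
Qed.

Let norm_dv k :
  `|v k.+1 - v k| <= (3 + gamma / mu) * `|v 0%N - u 0%N| * lambda k.
Proof.
have gm : 0 < 3 + gamma / mu by rewrite addr_gt0// divr_gt0.
apply: le_trans
  (step_diff_normV hip a0 b0 mu0 hgamma (step_pair (hstep k.+1) (hstep k))) _.
by rewrite -mulrA ler_pM2l.
Qed.

(** The residual stays below its initial value, so [u] and [v] move by O(lambda k) at step k. *)
Lemma cvg_of_summable_relaxation (M : R) :
  (forall n, \sum_(0 <= k < n) lambda k <= M) -> cvgn u /\ cvgn v.
Proof.
move=> lM; split.
- by apply: (cvg_of_summable_steps _ lM norm_du) => k; exact: ltW.
- by apply: (cvg_of_summable_steps _ lM norm_dv) => k; exact: ltW.
Qed.

(** A step with u = v = p has zero residual, so [xs] is a fixed point; compare the run with this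
    constant run. *)
Lemma fejer xs p ds : step xs p p ds -> forall k,
  `|x k.+1 - xs| ^+ 2 + lambda k * (c - lambda k) * `|v k - u k| ^+ 2
    + 2 * gamma * a * (lambda k * `|u k - p| ^+ 2)
    + 2 * gamma * b * (lambda k * `|v k - p| ^+ 2) <= `|x k - xs| ^+ 2.
Proof.
move=> hp k.
have := step_diff_norm hip mu0 hgamma (step_pair (hstep k) hp) (lambda0 k).
have -> : v k - p - (u k - p) = v k - u k by rewrite opprB addrA subrK.
by rewrite hx [x k - xs + _]addrAC.
Qed.

Section FixedPoint.
Context {xs p ds : H} (hp : step xs p p ds).

Lemma fejer_sum n :
  `|x n - xs| ^+ 2
    + \sum_(0 <= k < n) lambda k * (c - lambda k) * `|v k - u k| ^+ 2
    + 2 * gamma * a * \sum_(0 <= k < n) lambda k * `|u k - p| ^+ 2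
    + 2 * gamma * b * \sum_(0 <= k < n) lambda k * `|v k - p| ^+ 2
  <= `|x 0%N - xs| ^+ 2.
Proof.
elim: n => [|n IH]; first by rewrite !big_nil !mulr0 !addr0.
by rewrite !big_nat_recr//=; have := fejer hp n; lra.
Qed.

Let sumW0 n :
  0 <= \sum_(0 <= k < n) lambda k * (c - lambda k) * `|v k - u k| ^+ 2.
Proof. by apply: sumr_ge0 => k _; rewrite mulr_ge0// exprn_ge0. Qed.

Let sum0 (w : nat -> H) n : 0 <= \sum_(0 <= k < n) lambda k * `|w k - p| ^+ 2.
Proof. by apply: sumr_ge0 => k _; rewrite mulr_ge0// ?exprn_ge0// ltW. Qed.

Let sumU0 n : 0 <= 2 * gamma * a * \sum_(0 <= k < n) lambda k * `|u k - p| ^+ 2.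
Proof. by rewrite mulr_ge0// mulr_ge0// mulr_ge0// ltW. Qed.

Let sumV0 n : 0 <= 2 * gamma * b * \sum_(0 <= k < n) lambda k * `|v k - p| ^+ 2.
Proof. by rewrite mulr_ge0// mulr_ge0// mulr_ge0// ltW. Qed.

Lemma fejer_nonincreasing :
  {homo (fun k => `|x k - xs| ^+ 2) : n m / (n <= m)%N >-> m <= n}.
Proof.
apply/nonincreasing_seqP => k; have := fejer hp k.
have h (w : H) (s : R) : 0 <= s -> 0 <= 2 * gamma * s * (lambda k * `|w| ^+ 2).
  by move=> s0; rewrite !mulr_ge0// ?exprn_ge0// ltW.
have := h (u k - p) a a0; have := h (v k - p) b b0.
have : 0 <= lambda k * (c - lambda k) * `|v k - u k| ^+ 2.
  by rewrite mulr_ge0// exprn_ge0.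
lra.
Qed.

Lemma fejer_cvg : cvgn (fun k => `|x k - xs| ^+ 2).
Proof.
apply: nonincreasing_is_cvgn; first exact: fejer_nonincreasing.
by exists 0 => _ [k _ <-]; exact: exprn_ge0.
Qed.

Lemma fejer_le k : `|x k - xs| <= `|x 0%N - xs|.
Proof.
by rewrite -(@ler_pXn2r _ 2)// ?nnegrE//; exact: fejer_nonincreasing.
Qed.

(** Residuals bounded below by [e] would bound the divergent sum of weights through [fejer_sum].
    Hence one falls below [e], and monotonicity keeps the later ones there. *)
Lemma residual_cvg0 :
  (forall K, exists n, K < \sum_(0 <= k < n) lambda k * (c - lambda k)) ->
  (fun k => `|v k - u k|) @ \oo --> 0.
Proof.
move=> Sdiv; apply/cvgr0Pnorm_lt => e e0.
have [N hN] : exists N, `|v N - u N| < e.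
  apply: contrapT => /forallNP h.
  have e2 : 0 < e ^+ 2 by rewrite exprn_gt0.
  have [n] := Sdiv (`|x 0%N - xs| ^+ 2 / e ^+ 2).
  apply/negP; rewrite -leNgt ler_pdivlMr// mulr_suml.
  have := fejer_sum n; have := sumU0 n; have := sumV0 n.
  have : 0 <= `|x n - xs| ^+ 2 by rewrite exprn_ge0.
  have : \sum_(0 <= k < n) lambda k * (c - lambda k) * e ^+ 2 <=
         \sum_(0 <= k < n) lambda k * (c - lambda k) * `|v k - u k| ^+ 2.
    apply: ler_sum => k _; rewrite ler_wpM2l// lerXn2r// ?nnegrE ?(ltW e0)//.
    by rewrite leNgt; apply/negP.
  lra.
exists N => // k /= Nk; rewrite normr_id; apply: le_lt_trans hN.
exact: residual_nonincreasing.
Qed.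

(** Whichever modulus is positive, the squared distance of [u] or [v] to [p] is at most a constant
    times the residual; the other sequence follows as v - u -> 0. *)
Lemma cvg_of_residual : [|| 0 < a, 0 < b | 0 < t] ->
  (forall K, exists n, K < \sum_(0 <= k < n) lambda k * (c - lambda k)) ->
  u @ \oo --> p /\ v @ \oo --> p.
Proof.
move=> abt /residual_cvg0 W0.
have Wv : v @ \oo --> p -> u @ \oo --> p.
  move=> vp; rewrite -[p]subr0 (_ : u = fun k => v k - (v k - u k)); last first.
    by apply/funext => k; rewrite opprB addrC subrK.
  by apply: cvgB => //; apply/norm_cvg0P.
have Wu : u @ \oo --> p -> v @ \oo --> p.
  move=> up; rewrite -[p]addr0 (_ : v = fun k => u k + (v k - u k)); last first.
    by apply/funext => k; rewrite addrC subrK.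
  by apply: cvgD => //; apply/norm_cvg0P.
have Wk k : v k - p - (u k - p) = v k - u k by rewrite opprB addrA subrK.
have ipW k : - ip (x k - xs) (v k - u k) <= `|v k - u k| * `|x 0%N - xs|.
  rewrite ipC -ipNl; apply: le_trans (ip_le_norm hip _ _) _.
  by rewrite normrN ler_wpM2l// fejer_le.
have cW k : 0 <= c / 2 * `|v k - u k| ^+ 2.
  by rewrite !mulr_ge0// ?exprn_ge0// ltW//; exact: relaxation_gt0.
have g0 (w : H) (s : R) : 0 <= s -> 0 <= gamma * s * `|w| ^+ 2.
  by move=> s0; rewrite !mulr_ge0// ?exprn_ge0// ltW.
case/or3P: abt => lt0.
- have up : u @ \oo --> p.
    apply: (@cvg_of_sqr_norm _ _ _ _ _ (gamma * a) (`|x 0%N - xs|) _ _ W0) => [|k].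
      by rewrite mulr_gt0.
    have := step_diff_ip hip mu0 hgamma (step_pair (hstep k) hp).
    by rewrite Wk -/c; have := ipW k; have := cW k; have := g0 (v k - p) b b0; lra.
  by split=> //; exact: Wu.
- have vp : v @ \oo --> p.
    apply: (@cvg_of_sqr_norm _ _ _ _ _ (gamma * b) (`|x 0%N - xs|) _ _ W0) => [|k].
      by rewrite mulr_gt0.
    have := step_diff_ip hip mu0 hgamma (step_pair (hstep k) hp).
    by rewrite Wk -/c; have := ipW k; have := cW k; have := g0 (u k - p) a a0; lra.
  by split=> //; exact: Wv.
- have up : u @ \oo --> p.
    apply: (@cvg_of_sqr_norm _ _ _ _ _ (gamma * t)
      ((1 + gamma / mu) * `|x 0%N - xs|) _ _ W0) => [|k].
      by rewrite mulr_gt0.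
    have := step_diff_strongT hip a0 b0 mu0 hgamma (step_pair (hstep k) hp).
    rewrite Wk => /le_trans; apply; rewrite ler_wpM2l// ler_wpM2l// ?fejer_le//.
    by rewrite addr_ge0// divr_ge0// ltW.
  by split=> //; exact: Wu.
Qed.

Let dist_cvg0 (w : nat -> H) :
  (fun k => `|w k - p|) @ \oo --> 0 -> w @ \oo --> p.
Proof.
move=> /norm_cvg0P h; rewrite -[p]add0r.
rewrite (_ : w = fun k => w k - p + p); last by apply/funext => k; rewrite subrK.
by apply: cvgD => //; exact: cvg_cst.
Qed.

(** [fejer_sum] bounds the [lambda]-weighted sum of squared distances to [p], and the distances
    drift by O(lambda k), so [cvg0_of_summable] applies. *)
Lemma cvg_of_divergent_relaxation :
  (forall K, exists n, K < \sum_(0 <= k < n) lambda k) ->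
  (0 < a -> u @ \oo --> p) /\ (0 < b -> v @ \oo --> p).
Proof.
move=> Ldiv.
have lip (w : nat -> H) (C : R) : (forall k, `|w k.+1 - w k| <= C * lambda k) ->
    forall k, `| `|w k.+1 - p| - `|w k - p| | <= C * lambda k.
  move=> wC k; apply: le_trans (ler_dist_dist _ _) _.
  by rewrite opprB addrA subrK.
have X0 n : 0 <= `|x n - xs| ^+ 2 by rewrite exprn_ge0.
have lam0 k := ltW (lambda0 k).
split=> lt0; apply: dist_cvg0.
- have ga : 0 < 2 * gamma * a by rewrite !mulr_gt0.
  apply: (cvg0_of_summable lam0 _ _ Ldiv (lip _ _ norm_du)) => // n.
  rewrite -(ler_pM2l ga).
  (* The middle term fixes the still open bound of [cvg0_of_summable]. *)
  apply: (@le_trans _ _ (2 * gamma * a * (`|x 0%N - xs| ^+ 2 / (2 * gamma * a)))).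
    rewrite [leRHS]mulrC divfK ?gt_eqF//.
    by have := fejer_sum n; have := sumV0 n; have := sumW0 n; have := X0 n; lra.
  exact: lexx.
- have gb : 0 < 2 * gamma * b by rewrite !mulr_gt0.
  apply: (cvg0_of_summable lam0 _ _ Ldiv (lip _ _ norm_dv)) => // n.
  rewrite -(ler_pM2l gb).
  apply: (@le_trans _ _ (2 * gamma * b * (`|x 0%N - xs| ^+ 2 / (2 * gamma * b)))).
    rewrite [leRHS]mulrC divfK ?gt_eqF//.
    by have := fejer_sum n; have := sumU0 n; have := sumW0 n; have := X0 n; lra.
  exact: lexx.
Qed.

End FixedPoint.
End Run.

(** * Resolvents and the cocoercivity of the shifted [T] *)

Section Resolvent.
Context {R : realType} {H : completeNormedModType R}.
Context {ip : {dot H for (idfun : R -> R)}} (hip : norm_from_dot ip).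
Implicit Types (A B : operator H) (T : H -> H).

Lemma monotone_op_add (alpha beta : R) A B :
  monotone_op ip alpha A -> monotone_op ip beta B ->
  monotone_op ip (alpha + beta) (op_add A B).
Proof.
move=> hA hB x y _ _ [a Ax [b Bx <-]] [a' Ay [b' By <-]].
by have := hA _ _ _ _ Ax Ay; have := hB _ _ _ _ Bx By; rewrite !ipE; lra.
Qed.

(** For two values u and u', monotonicity gives (1 + c alpha) |u' - u|^2 <= 0. Thus exhibiting one
    value determines the resolvent. *)
Lemma resolvent_set1 (alpha c : R) A y u : monotone_op ip alpha A ->
  0 <= c -> 0 < 1 + c * alpha -> resolvent c A y u ->
  resolvent c A y = [set u].
Proof.
move=> hA c0 calpha hu; apply/seteqP; split=> [u' hu'|_ ->//] /=.
case: hu => _ -> [_ [w Au <-] yu]; case: hu' => _ -> [_ [w' Au' <-] yu'].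
apply/eqP; rewrite -subr_eq0 -normr_eq0 -sqrf_eq0; apply/eqP/le_anti.
rewrite exprn_ge0// andbT -(pmulr_rle0 _ calpha).
have := hA _ _ _ _ Au' Au; rewrite -(subr_ge0 (alpha * _)) => /(mulr_ge0 c0).
have -> : c * (ip (u' - u) (w' - w) - alpha * `|u' - u| ^+ 2) =
    ip (u' - u) (c *: w' - c *: w) - c * alpha * `|u' - u| ^+ 2.
  by rewrite !ipE; ring.
have -> : c *: w' - c *: w = - (u' - u).
  apply/(ip_inj hip) => z.
  by move: (congr1 (ip^~ z) (etrans yu (esym yu'))); rewrite !ipE; lra.
by rewrite ipNr -(hip (u' - u)); lra.
Qed.

(** Multiplying the resolvent equation by [m] turns the normalized resolvents of the iteration into
    the inclusions of [davis_yin_step]. *)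
Lemma resolvent_scaleP (g m : R) A y u : g != 0 -> m != 0 ->
  resolvent (g / m) A (m^-1 *: y) u <-> A u (g^-1 *: (y - m *: u)).
Proof.
move=> g0 m0; split=> [[_ -> [_ [w Au <-] yu]]|Au].
  suff -> : g^-1 *: (y - m *: u) = w by [].
  apply/(ip_inj hip) => z; move: (congr1 (ip^~ z) yu); rewrite !ipE => /(congr1 ( *%R m)).
  rewrite mulVKf// => <-; field; exact/andP.
exists u => //; eexists; first by eexists; [exact: Au|reflexivity].
by apply/(ip_inj hip) => z; rewrite !ipE; field; exact/andP.
Qed.

Lemma cocoercive_shift (beta theta sigma : R) T : 0 < beta -> 0 < theta ->
  0 <= sigma -> cocoercive ip beta T -> forall x y,
  (theta / beta + sigma)^-1 * `|theta *: (T x - T y) + sigma *: (x - y)| ^+ 2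
  <= ip (x - y) (theta *: (T x - T y) + sigma *: (x - y)).
Proof.
move=> b0 t0 s0 hT x y; have := hT x y.
move: (x - y) (T x - T y) => U E hE.
have k0 : 0 < theta / beta by rewrite divr_gt0.
rewrite mulrC ler_pdivrMr ?ltr_wpDr// (hip (_ + _)) !ipE (ipC E U).
rewrite -(hip E) -(hip U).
have UE : beta * ip U E <= `|U| ^+ 2.
  have : 0 <= `|U - beta *: E| ^+ 2 by rewrite exprn_ge0.
  rewrite hip !ipE (ipC E U) -(hip E) -(hip U).
  have : beta * (beta * `|E| ^+ 2) <= beta * ip U E by rewrite ler_pM2l.
  lra.
rewrite -subr_ge0.
(* The defect is a nonnegative combination of cocoercivity and of [UE]. *)
rewrite (_ : _ - _ = theta ^+ 2 / beta * (ip U E - beta * `|E| ^+ 2)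
    + theta * sigma / beta * (`|U| ^+ 2 - beta * ip U E)); last first.
  by field; rewrite gt_eqF.
by rewrite addr_ge0// mulr_ge0// ?subr_ge0// !mulr_ge0 ?invr_ge0 ?exprn_ge0// ltW.
Qed.

End Resolvent.

(** * The concrete step, its fixed points and its closedness *)

Section DavisYinStep.
Context {R : realType} {H : completeNormedModType R}.
Context {ip : {dot H for (idfun : R -> R)}} (hip : norm_from_dot ip).
Context (A B : operator H) (T : H -> H).
Context (theta gamma sigmaA sigmaB sigmaT : R) (q : H).
Hypotheses (theta0 : 0 < theta) (gamma0 : 0 < gamma).

(** The inclusions read x - u in gamma (theta A u + sigmaA (u - q)), and similarly for [v]. [d] is
    the shifted [T] at [u] up to the constant sigmaT q, which cancels in differences. *)
Definition davis_yin_step (x u v d : H) : Prop :=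
  [/\ A u ((gamma * theta)^-1 *:
        (x + (gamma * sigmaA) *: q - (1 + gamma * sigmaA) *: u)),
      B v ((gamma * theta)^-1 *:
        ((2 - gamma * sigmaT) *: u - x - (theta * gamma) *: T u
         + (gamma * (sigmaB + sigmaT)) *: q - (1 + gamma * sigmaB) *: v))
    & d = theta *: T u + sigmaT *: u].

Lemma davis_yin_step_diff (alphaA alphaB alphaT beta : R) :
  monotone_op ip alphaA A -> monotone_op ip alphaB B ->
  monotone_op ip alphaT (op_fun T) -> 0 < beta -> cocoercive ip beta T ->
  0 <= sigmaT -> forall x u v d x' u' v' d',
  davis_yin_step x u v d -> davis_yin_step x' u' v' d' ->
  step_diff ip (theta * alphaA + sigmaA) (theta * alphaB + sigmaB)
    (theta * alphaT + sigmaT) (theta / beta + sigmaT)^-1 gamma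
    (x - x') (u - u') (v - v') (d - d').
Proof.
move=> hA hB hT beta0 hTc sigmaT0 x u v d x' u' v' d' [Au Bv ->] [Au' Bv' ->].
have gt0 : 0 < gamma * theta by rewrite mulr_gt0.
have dE : theta *: T u + sigmaT *: u - (theta *: T u' + sigmaT *: u') =
    theta *: (T u - T u') + sigmaT *: (u - u').
  by apply/(ip_inj hip) => z; rewrite !ipE; ring.
rewrite dE; split.
- have := hA _ _ _ _ Au Au'; rewrite -(ler_pM2l gt0).
  rewrite -scalerBr ipZr mulVKf ?gt_eqF// !(hip (u - u')) !ipE; lra.
- have := hB _ _ _ _ Bv Bv'; rewrite -(ler_pM2l gt0).
  rewrite -scalerBr ipZr mulVKf ?gt_eqF// !(hip (v - v')) !ipE; lra.
- exact: cocoercive_shift.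
- have := hT u u' (T u) (T u') erefl erefl; rewrite -(ler_pM2l theta0).
  by rewrite !ipDr !ipZr -(hip (u - u')); lra.
Qed.

(** The equation for [q] says that [p] is a zero of the sum of the shifted operators; the fixed
    point is [p] plus gamma times the element of the shifted [A] used there. *)
Lemma davis_yin_fixed_point p a b : A p a -> B p b ->
  sigmaA + sigmaB + sigmaT != 0 ->
  p + (theta / (sigmaA + sigmaB + sigmaT)) *: (a + b + T p) = q ->
  davis_yin_step (p + gamma *: (theta *: a + sigmaA *: (p - q))) p p
    (theta *: T p + sigmaT *: p).
Proof.
move=> Apa Bpb s0; rewrite /davis_yin_step => <-.
have tn0 : theta != 0 by rewrite gt_eqF.
have gn0 : gamma != 0 by rewrite gt_eqF.
split=> //.
- rewrite (_ : _ *: _ = a)//; apply/(ip_inj hip) => z; rewrite !ipE; field.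
  by rewrite s0 tn0 gn0.
- rewrite (_ : _ *: _ = b)//; apply/(ip_inj hip) => z; rewrite !ipE; field.
  by rewrite s0 tn0 gn0.
Qed.

(* Strong convergence of [u] and [v] to [p] lets the inclusions defining a step
   pass to the limit at any weak center of [x]. *)
Lemma davis_yin_step_closed (alphaA alphaB beta : R) (F : set_system nat)
    (x u v d : nat -> H) (M : R) p z :
  ProperFilter F ->
  max_monotone_op ip alphaA A -> max_monotone_op ip alphaB B ->
  0 < beta -> cocoercive ip beta T ->
  (forall k, davis_yin_step (x k) (u k) (v k) (d k)) ->
  u k @[k --> F] --> p -> v k @[k --> F] --> p ->
  (forall k, `|x k| <= M) -> weak_center ip F x z ->
  davis_yin_step z p p (theta *: T p + sigmaT *: p).
Proof.
move=> FF hA hB beta0 hTc hstep up vp xM xz.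
have Tup : T (u k) @[k --> F] --> T p.
  apply/cvgrPdist_lt => e e0.
  have be : 0 < beta * e by rewrite mulr_gt0.
  move/cvgrPdist_lt : up => /(_ _ be); apply: filterS => k.
  have [->|Tn] := eqVneq (T p) (T (u k)); first by rewrite subrr normr0.
  have Tp : 0 < `|T p - T (u k)| by rewrite normr_gt0 subr_eq0.
  move=> uk; rewrite -(ltr_pM2l beta0); apply: le_lt_trans uk.
  rewrite -(ler_pM2r Tp) -mulrA -expr2.
  exact: le_trans (hTc _ _) (ip_le_norm hip _ _).
split=> //.
(* Isolate the multiple of [x], known only through its weak center; the remainder [h] converges
   strongly. *)
- pose h (k : nat) := (gamma * theta)^-1 *:
     ((gamma * sigmaA) *: q - (1 + gamma * sigmaA) *: u k).
  have -> : (gamma * theta)^-1 *: (z + (gamma * sigmaA) *: q - (1 + gamma * sigmaA) *: p)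
      = (gamma * theta)^-1 *: z + (gamma * theta)^-1 *:
        ((gamma * sigmaA) *: q - (1 + gamma * sigmaA) *: p).
    by rewrite -scalerDr addrA.
  apply: (max_monotone_closed_affine hip (x := x) (h := h) hA _ up _ xM xz) => [k|].
    by rewrite /h -scalerDr addrA; case: (hstep k).
  by apply: cvgZr; apply: cvgB; [exact: cvg_cst|exact: cvgZr].
- pose h (k : nat) := (gamma * theta)^-1 *:
     ((2 - gamma * sigmaT) *: u k - (theta * gamma) *: T (u k)
      + (gamma * (sigmaB + sigmaT)) *: q - (1 + gamma * sigmaB) *: v k).
  have E y u' v' : (gamma * theta)^-1 *:
        ((2 - gamma * sigmaT) *: u' - y - (theta * gamma) *: T u'
         + (gamma * (sigmaB + sigmaT)) *: q - (1 + gamma * sigmaB) *: v') =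
      - (gamma * theta)^-1 *: y + (gamma * theta)^-1 *:
     ((2 - gamma * sigmaT) *: u' - (theta * gamma) *: T u'
      + (gamma * (sigmaB + sigmaT)) *: q - (1 + gamma * sigmaB) *: v').
    by apply/(ip_inj hip) => e; rewrite !ipE; ring.
  rewrite E.
  apply: (max_monotone_closed_affine hip (x := x) (h := h) hB _ vp _ xM xz) => [k|].
    by rewrite /h -E; case: (hstep k).
  apply: cvgZr; apply: cvgB; last exact: cvgZr.
  apply: cvgD; last exact: cvg_cst.
  by apply: cvgB; exact: cvgZr.
Qed.

End DavisYinStep.

(** * Assembly of the convergence theorem *)

Unset Implicit Arguments.

Theorem theorem3p6 (R : realType) (H : completeNormedModType R)
  (ip : {dot H for (idfun : R -> R)}) (hip : norm_from_dot ip)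
  (alphaA alphaB alphaT : R) (A B : operator H) (T : H -> H) (beta : R)
  (hA : max_monotone_op ip alphaA A)
  (hB : max_monotone_op ip alphaB B)
  (hbeta : 0 < beta)
  (hTc : cocoercive ip beta T)
  (hTm : max_monotone_op ip alphaT (op_fun T))
  (theta sigmaA sigmaB sigmaT : R)
  (htheta : 0 < theta) (hsigmaT : 0 <= sigmaT)
  (hsigma : 0 < sigmaA + sigmaB + sigmaT)
  (hnneg : [/\ 0 <= theta * alphaA + sigmaA,
               0 <= theta * alphaB + sigmaB
             & 0 <= theta * alphaT + sigmaT])
  (hnz : (theta * alphaA + sigmaA, theta * alphaB + sigmaB,
          theta * alphaT + sigmaT) <> (0, 0, 0))
  (mu gamma : R)
  (hmu : mu = (theta / beta + sigmaT)^-1)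
  (hgamma : 0 < gamma < 4 * mu)
  (hgA : 0 < 1 + gamma * sigmaA)
  (hgB : 0 < 1 + gamma * sigmaB)
  (lambda : nat -> R)
  (hlambda : forall k, 0 < lambda k <= 2 - gamma / (2 * mu))
  (q : H)
  (hq : ran (op_add (@op_id H)
               (op_scale (theta / (sigmaA + sigmaB + sigmaT))
                  (op_add (op_add A B) (op_fun T)))) q)
  (x u v : nat -> H)
  (hu : forall k,
     resolvent (gamma * theta / (1 + gamma * sigmaA)) A
       ((1 + gamma * sigmaA)^-1 *: (x k + (gamma * sigmaA) *: q))
     = [set u k])
  (hv : forall k,
     resolvent (gamma * theta / (1 + gamma * sigmaB)) B
       ((1 + gamma * sigmaB)^-1 *:
          ((2 - gamma * sigmaT) *: u k - x k - (theta * gamma) *: T (u k)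
           + (gamma * (sigmaB + sigmaT)) *: q))
     = [set v k])
  (hx : forall k, x k.+1 = x k + lambda k *: (v k - u k)) :
  let S := (\sum_(0 <= k <oo)
              (lambda k * (2 - gamma / (2 * mu) - lambda k))%:E)%E in
  let L := (\sum_(0 <= k <oo) (lambda k)%:E)%E in
  exists p : H,
    [/\ resolvent (theta / (sigmaA + sigmaB + sigmaT))
          (op_add (op_add A B) (op_fun T)) q = [set p],
        S = +oo%E ->
          [/\ weakly_cvg ip u p, weakly_cvg ip v p
            & exists2 xbar : H, weakly_cvg ip x xbar
              & resolvent (gamma * theta / (1 + gamma * sigmaA)) A
                  ((1 + gamma * sigmaA)^-1 *:
                     (xbar + (gamma * sigmaA) *: q)) = [set p]],
        0 < theta * alphaA + sigmaA ->
          [/\ S = +oo%E -> u @ \oo --> p,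
              (S < +oo)%E -> exists l : H, u @ \oo --> l
            & (S < +oo)%E -> L = +oo%E -> u @ \oo --> p]
      & 0 < theta * alphaB + sigmaB ->
          [/\ S = +oo%E -> v @ \oo --> p,
              (S < +oo)%E -> exists l : H, v @ \oo --> l
            & (S < +oo)%E -> L = +oo%E -> v @ \oo --> p]].
Proof.
move=> S L.
have [a0 b0 t0] := hnneg.
have /andP[gamma0 gamma4] := hgamma.
have mu0 : 0 < mu by rewrite hmu invr_gt0 ltr_wpDr// divr_gt0.
have sn0 : sigmaA + sigmaB + sigmaT != 0 by rewrite gt_eqF.
have gtn0 : gamma * theta != 0 by rewrite gt_eqF// mulr_gt0.
have mAn0 : 1 + gamma * sigmaA != 0 by rewrite gt_eqF.
have mBn0 : 1 + gamma * sigmaB != 0 by rewrite gt_eqF.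
have abt : [|| 0 < theta * alphaA + sigmaA, 0 < theta * alphaB + sigmaB
             | 0 < theta * alphaT + sigmaT].
  rewrite !lt0r a0 b0 t0 !andbT -!negb_and; apply/negP => /and3P[/eqP hA0 /eqP hB0 /eqP hT0].
  by apply: hnz; rewrite hA0 hB0 hT0.
have abt0 : 0 < (theta * alphaA + sigmaA) + (theta * alphaB + sigmaB)
                + (theta * alphaT + sigmaT).
  by case/or3P: abt; lra.
case: hq => p [_ -> [_ [_ [_ [a Apa [b Bpb <-]] [_ -> <-]] <-] pq]].
have resp : resolvent (theta / (sigmaA + sigmaB + sigmaT))
    (op_add (op_add A B) (op_fun T)) q = [set p].
  apply: (@resolvent_set1 _ _ _ hip (alphaA + alphaB + alphaT)).
  - by apply: monotone_op_add; [apply: monotone_op_add; [case: hA|case: hB]|case: hTm].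
  - by rewrite divr_ge0// ltW.
  (* The resolvent is single-valued because this factor is the sum of the three shifted moduli over
     the sum of the shifts. *)
  - rewrite (_ : 1 + _ = (theta * alphaA + sigmaA + (theta * alphaB + sigmaB)
      + (theta * alphaT + sigmaT)) / (sigmaA + sigmaB + sigmaT)); last by field.
    by rewrite divr_gt0.
  - exists p => //; exists ((theta / (sigmaA + sigmaB + sigmaT)) *: (a + b + T p)) => //.
    exists (a + b + T p) => //; exists (a + b); first by exists a => //; exists b.
    by exists (T p).
pose step := davis_yin_step A B T theta gamma sigmaA sigmaB sigmaT q.
pose d k := theta *: T (u k) + sigmaT *: u k.
have hstep k : step (x k) (u k) (v k) (d k).
  split=> //.
  - by apply/(resolvent_scaleP hip _ _ _ gtn0 mAn0); rewrite hu.
  - by apply/(resolvent_scaleP hip _ _ _ gtn0 mBn0); rewrite hv.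
have step_pair x1 u1 v1 d1 x2 u2 v2 d2 : step x1 u1 v1 d1 -> step x2 u2 v2 d2 ->
    step_diff ip (theta * alphaA + sigmaA) (theta * alphaB + sigmaB)
    (theta * alphaT + sigmaT) mu gamma
    (x1 - x2) (u1 - u2) (v1 - v2) (d1 - d2).
  rewrite hmu; apply: davis_yin_step_diff => //; [by case: hA|by case: hB|by case: hTm].
have hp := davis_yin_fixed_point hip htheta gamma0 Apa Bpb sn0 pq.
set xs := (X in davis_yin_step _ _ _ _ _ _ _ _ _ X) in hp.
have lambda0 k : 0 <= lambda k by case/andP: (hlambda k) => /ltW.
have relax0 k : 0 <= lambda k * (2 - gamma / (2 * mu) - lambda k).
  by case/andP: (hlambda k) => h1 h2; rewrite mulr_ge0// subr_ge0.
have cvgS : S = +oo%E -> u @ \oo --> p /\ v @ \oo --> p.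
  move=> /(nneseries_unbounded relax0) Sdiv.
  exact: (cvg_of_residual hip a0 b0 mu0 hgamma step_pair hlambda hstep hx hp abt Sdiv).
have cvgL : L = +oo%E -> (0 < theta * alphaA + sigmaA -> u @ \oo --> p) /\
                         (0 < theta * alphaB + sigmaB -> v @ \oo --> p).
  move=> /(nneseries_unbounded lambda0).
  exact: (cvg_of_divergent_relaxation hip a0 b0 mu0 hgamma step_pair hlambda hstep hx hp).
have cvgL' : (L < +oo)%E -> cvgn u /\ cvgn v.
  move=> /(nneseries_bounded lambda0)[M hM].
  exact: (cvg_of_summable_relaxation hip a0 b0 mu0 hgamma step_pair hlambda hstep hx hM).
(* Split on the sum of [lambda]: if it diverges the limit is [p]; if it is finite, the sequence
   still converges, to a limit not identified here. *)
have exl (w : nat -> H) (P : Prop) : P ->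
    (L = +oo%E -> P -> w @ \oo --> p) -> ((L < +oo)%E -> cvgn w) ->
    exists l : H, w @ \oo --> l.
  move=> hP h1 h2; have [Loo|Loo] := eqVneq L +oo%E; first by exists p; exact: h1.
  by exists (limn w); apply: h2; rewrite ltey.
exists p; split=> //.
- move=> Soo; have [up vp] := cvgS Soo.
  split; [exact: cvg_weakly_cvg|exact: cvg_weakly_cvg|].
  have xM k : `|x k| <= `|x 0%N - xs| + `|xs|.
    rewrite -[x k](subrK xs); apply: le_trans (ler_normD _ _) _; rewrite lerD2r.
    exact: (fejer_le hip a0 b0 mu0 hgamma step_pair hlambda hstep hx hp).
  (* Opial with the fixed points lying over [p]: closedness puts every weak center among them, and
     Fejer monotonicity gives convergent distances to each. *)
  have [||z hz xz] := @weakly_cvg_opial _ _ _ hip x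
    (fun z => step z p p (theta *: T p + sigmaT *: p)) _ xM.
  + move=> F FF Foo z xz.
    apply: (davis_yin_step_closed hip FF hA hB hbeta hTc hstep _ _ xM xz).
    * exact: cvg_trans (cvg_app _ Foo) up.
    * exact: cvg_trans (cvg_app _ Foo) vp.
  + move=> z hz.
    exact: (fejer_cvg hip a0 b0 mu0 hgamma step_pair hlambda hstep hx hz).
  exists z => //; apply: (@resolvent_set1 _ _ _ hip alphaA).
  - by case: hA.
  - by rewrite divr_ge0// ?mulr_ge0// ltW.
  - rewrite (_ : 1 + _ = (1 + gamma * (theta * alphaA + sigmaA))
      / (1 + gamma * sigmaA)); last by field.
    by rewrite divr_gt0// ltr_wpDr// mulr_ge0// ltW.
  - by apply/(resolvent_scaleP hip _ _ _ gtn0 mAn0); case: hz.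
- move=> lt0; split=> [/cvgS[]//|_|_ /cvgL[+ _]]; last exact.
  apply: (exl u _ lt0) => [/cvgL[]//|/cvgL'[]//].
- move=> lt0; split=> [/cvgS[]//|_|_ /cvgL[_ +]]; last exact.
  apply: (exl v _ lt0) => [/cvgL[]//|/cvgL'[]//].
Qed.
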